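(* Let $\{K^{(n)}_{\cdot}(\cdot,\cdot)\}_{n\in\mathbb{N}^+}$ be a family of CPTNI monotone metrics. Then for every $n\in\mathbb{N}^+$, all $\rho_1,\rho_2\in\overline{\mathcal{S}}^{++}(\mathbb{C}^n)$, and all $X_1,X_2\in\mathcal{B}(\mathbb{C}^n)$, $$K^{(n)}_{\frac{\rho_1+\rho_2}{2}}\left(\frac{X_1+X_2}{2},\frac{X_1+X_2}{2}\right)\le\frac12\left\{K^{(n)}_{\rho_1}(X_1,X_1)+K^{(n)}_{\rho_2}(X_2,X_2)\right\}.$$
   Context: Notation. $\mathbb{N}^+$ is the set of positive integers and $\mathcal{B}(\mathbb{C}^n)$ is the set of all linear operators on $\mathbb{C}^n$. Set $\overline{\mathcal{S}}^{++}(\mathbb{C}^n)=\{\rho\in\mathcal{B}(\mathbb{C}^n)\mid \operatorname{Tr}\rho\le 1,\ \rho>0\}$ (strictly positive operators of trace at most one) and $\overline{\mathcal{S}}(\mathbb{C}^n)=\{\rho\in\mathcal{B}(\mathbb{C}^n)\mid \operatorname{Tr}\rho\le 1,\ \rho\ge 0\}$. A CPTNI (completely positive, trace non-increasing) map $T:\mathcal{B}(\mathbb{C}^n)\to\mathcal{B}(\mathbb{C}^m)$ is a map of the form $T(X)=\sum_{i=1}^k A_iXA_i^*$ with linear maps $A_1,\dots,A_k:\mathbb{C}^n\to\mathbb{C}^m$ such that $\sum_{i=1}^k A_i^*A_i\le I$. The set of all of them is denoted $\overline{\mathcal{C}}(\mathbb{C}^n,\mathbb{C}^m)$. A family of functions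 $\{K^{(n)}_{\cdot}(\cdot,\cdot)\}_{n\in\mathbb{N}^+}$ from $\overline{\mathcal{S}}^{++}(\mathbb{C}^n)\times\mathcal{B}(\mathbb{C}^n)\times\mathcal{B}(\mathbb{C}^n)$ to $\mathbb{C}$ is a family of CPTNI monotone metrics if: (a) for every $n\in\mathbb{N}^+$ and $\rho\in\overline{\mathcal{S}}^{++}(\mathbb{C}^n)$, the map $(X,Y)\mapsto K^{(n)}_\rho(X,Y)$ is a (complex, positive definite) inner product on $\mathcal{B}(\mathbb{C}^n)$, conjugate-linear in the first argument and linear in the second; (b) for every $n,m\in\mathbb{N}^+$, $T\in\overline{\mathcal{C}}(\mathbb{C}^n,\mathbb{C}^m)$, $X\in\mathcal{B}(\mathbb{C}^n)$, $\rho\in\overline{\mathcal{S}}^{++}(\mathbb{C}^n)$, and $\sigma\in\overline{\mathcal{S}}(\mathbb{C}^m)$ such that $T(\rho)+\sigma\in\overline{\mathcal{S}}^{++}(\mathbb{C}^m)$, one has $K^{(m)}_{T(\rho)+\sigma}(T(X),T(X))\le K^{(n)}_\rho(X,X)$. No continuity in $\rho$ is assumed. *)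

(* Defs.v *)
From mathcomp Require Import all_boot all_order all_algebra.
From mathcomp Require Import reals complex.

Set Implicit Arguments.
Unset Strict Implicit.
Unset Printing Implicit Defensive.

Import Order.TTheory GRing.Theory Num.Theory.
Local Open Scope ring_scope.
Local Open Scope sesquilinear_scope.

(* The complex numbers are R[i] with R : realType, and B(C^n) is 'M[R[i]]_n,
   acting on column vectors. The order on R[i] is the partial one: x <= y
   (resp. x < y) means that y - x is a real number that is >= 0 (resp. > 0).
   Hence the two positivity predicates below entail that A is Hermitian. *)

Definition psdmx (R : realType) (n : nat) (A : 'M[R[i]]_n) : Prop :=
  forall x : 'cV[R[i]]_n, 0 <= (x ^t* *m A *m x) 0 0.

Definition posdefmx (R : realType) (n : nat) (A : 'M[R[i]]_n) : Prop :=
  forall x : 'cV[R[i]]_n, x != 0 -> 0 < (x ^t* *m A *m x) 0 0.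

Definition substate (R : realType) (n : nat) (rho : 'M[R[i]]_n) : Prop :=
  \tr rho <= 1 /\ psdmx rho.

Definition pos_substate (R : realType) (n : nat) (rho : 'M[R[i]]_n) : Prop :=
  \tr rho <= 1 /\ posdefmx rho.

Definition cptni (R : realType) (n m : nat)
    (T : 'M[R[i]]_n -> 'M[R[i]]_m) : Prop :=
  exists (k : nat) (A : 'I_k -> 'M[R[i]]_(m, n)),
    (forall X : 'M[R[i]]_n, T X = \sum_(i < k) A i *m X *m (A i) ^t*) /\
    psdmx (1%:M - \sum_(i < k) (A i) ^t* *m A i).

(* {dot U for conj} is the type of positive definite Hermitian forms that are
   linear in the FIRST argument and conjugate-linear in the second; the
   arguments are exchanged so that f is conjugate-linear in the first one. *)
Definition inner_product (R : realType) (n : nat)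
    (f : 'M[R[i]]_n -> 'M[R[i]]_n -> R[i]) : Prop :=
  exists g : {dot 'M[R[i]]_n for Num.conj},
    forall X Y : 'M[R[i]]_n, f X Y = g Y X.

(* K n rho is only constrained when 0 < n and pos_substate rho: its values
   elsewhere are irrelevant. *)
Record cptni_monotone_metrics (R : realType)
    (K : forall n : nat, 'M[R[i]]_n -> 'M[R[i]]_n -> 'M[R[i]]_n -> R[i]) :
    Prop := CPTNIMonotoneMetrics {
  metric_inner_product : forall (n : nat) (rho : 'M[R[i]]_n),
    (0 < n)%N -> pos_substate rho -> inner_product (K n rho);
  metric_monotone : forall (n m : nat) (T : 'M[R[i]]_n -> 'M[R[i]]_m)
      (X rho : 'M[R[i]]_n) (sigma : 'M[R[i]]_m),
    (0 < n)%N -> (0 < m)%N -> cptni T -> pos_substate rho ->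
    substate sigma -> pos_substate (T rho + sigma) ->
    K m (T rho + sigma) (T X) (T X) <= K n rho X X
}.

(* Main.v *)
(** Compressing a block-diagonal state to its first summand and adding the second
    summand back as [sigma] fixes the state, so this compression is an idempotent
    contraction, hence an orthogonal projection, for the metric at that state:
    the metric is additive over direct sums of tangent vectors. Duplicating
    [rho] to [rho/2 (+) rho/2] therefore puts half of [K_rho (X, X)] at most in
    each summand, whatever state occupies the other one. Applying the partial
    trace to [rho1/2 (+) rho2/2] and [X1/2 (+) X2/2] gives midpoint convexity. *)

Require Import Defs.
From mathcomp Require Import all_boot all_order all_algebra.
From mathcomp Require Import reals complex.

Import Order.TTheory GRing.Theory Num.Theory.
Local Open Scope ring_scope.
Local Open Scope sesquilinear_scope.

Local Notation dsum a b := (block_mx a 0 0 b).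

(** For the [t] that makes [w = u + t *: v] orthogonal to [v], Pythagoras gives
    [g u u = g w w + |t|^2 * g v v]. Minimality of [u] then forces [t = 0], so [u = w]. *)
Lemma dot_orthogonal_of_minimal (C : numClosedFieldType) (U : lmodType C)
    (g : {dot U for Num.conj}) (u v : U) :
  (forall t : C, g u u <= g (u + t *: v) (u + t *: v)) -> g u v = 0.
Proof.
move=> min_u; have [->|v_neq0] := eqVneq v 0; first by rewrite linear0r.
have gv_gt0 : 0 < g v v by rewrite dnorm_gt0.
pose t := - (g u v / g v v); pose w := u + t *: v.
have gwv : g w v = 0.
  by rewrite linearDl linearZl_LR /= mulNr divfK ?subrr ?gt_eqF.
have := min_u t; rewrite -/w.
have -> : u = w - t *: v by rewrite addrK.
have gwtv : g w (t *: v) = 0 by rewrite linearZr_LR /= gwv mulr0.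
rewrite dnormB /= gwtv conjC0 addr0 subr0 dnormZ.
rewrite gerDl pmulr_lle0 // => t_le0.
have /eqP : `|t| ^+ 2 = 0 by apply/eqP; rewrite eq_le t_le0 exprn_ge0.
rewrite expf_eq0 /= normr_eq0 => /eqP t0.
by rewrite t0 scale0r subr0.
Qed.

(** * Positivity of direct sums, and maps with one or two Kraus operators *)

Section DirectSums.
Context {R : realType}.
Implicit Types n m : nat.

Lemma psd_posdefmx n (A : 'M[R[i]]_n) : posdefmx A -> psdmx A.
Proof.
move=> A_pos x; have [->|/A_pos/ltW//] := eqVneq x 0.
by rewrite mulmx0 mxE.
Qed.

Lemma psdmx0 n : psdmx (0 : 'M[R[i]]_n).
Proof. by move=> x; rewrite mulmx0 mul0mx mxE. Qed.

Lemma substate0 n : substate (0 : 'M[R[i]]_n).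
Proof. by split; [rewrite mxtrace0 ler01 | exact: psdmx0]. Qed.

Lemma psdmx1 n : psdmx (1%:M : 'M[R[i]]_n).
Proof.
move=> x; rewrite mulmx1 mxE sumr_ge0 // => j _.
by rewrite !mxE mulrC mul_conjC_ge0.
Qed.

Lemma quad_dsum n (a b : 'M[R[i]]_n) (x : 'cV[R[i]]_(n + n)) :
  (x ^t* *m dsum a b *m x) 0 0 =
    ((usubmx x) ^t* *m a *m usubmx x) 0 0 +
    ((dsubmx x) ^t* *m b *m dsubmx x) 0 0.
Proof.
rewrite -{1 2}[x]vsubmxK tr_col_mx map_row_mx mul_row_block !mulmx0 addr0 add0r.
by rewrite mul_row_col mxE.
Qed.

Lemma psdmx_dsum n (a b : 'M[R[i]]_n) :
  psdmx a -> psdmx b -> psdmx (dsum a b).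
Proof. by move=> a_psd b_psd x; rewrite quad_dsum addr_ge0. Qed.

Lemma posdefmx_dsum n (a b : 'M[R[i]]_n) :
  posdefmx a -> posdefmx b -> posdefmx (dsum a b).
Proof.
move=> a_pos b_pos x x_neq0; rewrite quad_dsum.
have [u0|u_neq0] := eqVneq (usubmx x) 0; last first.
  by apply: ltr_wpDr; [exact: psd_posdefmx | exact: a_pos].
apply: ltr_wpDl; first exact: psd_posdefmx.
apply: b_pos; apply: contra_neq x_neq0 => d0.
by rewrite -[x]vsubmxK u0 d0 col_mx0.
Qed.

Lemma posdefmx_half n (a : 'M[R[i]]_n) : posdefmx a -> posdefmx (2^-1 *: a).
Proof.
move=> a_pos x /a_pos xax_gt0.
by rewrite -scalemxAr -scalemxAl mxE mulr_gt0 // invr_gt0 ltr0n.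
Qed.

Lemma posdefmx_trace_ge0 n (a : 'M[R[i]]_n) : posdefmx a -> 0 <= \tr a.
Proof.
move=> /psd_posdefmx a_psd; rewrite /mxtrace sumr_ge0 // => j _.
pose e : 'cV[R[i]]_n := delta_mx j 0.
suff -> : a j j = (e ^t* *m a *m e) 0 0 by exact: a_psd.
by rewrite trmx_delta map_delta_mx -rowE -colE !mxE.
Qed.

(** One Kraus operator suffices for the swap and the compression; duplication and partial trace take
    two. *)
Lemma cptni1 n m (A : 'M[R[i]]_(m, n)) :
  psdmx (1%:M - A ^t* *m A) -> cptni (fun X => A *m X *m A ^t*).
Proof.
by move=> A_le1; exists 1, (fun=> A); rewrite big_ord1; split=> // X;
   rewrite big_ord1.
Qed.

Lemma cptni2 n m (A B : 'M[R[i]]_(m, n)) :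
  psdmx (1%:M - (A ^t* *m A + B ^t* *m B)) ->
  cptni (fun X => A *m X *m A ^t* + B *m X *m B ^t*).
Proof.
move=> AB_le1; exists 2, (fun i => if i == 0 then A else B).
by rewrite !big_ord_recl big_ord0 addr0; split=> // X;
   rewrite !big_ord_recl big_ord0 addr0.
Qed.

End DirectSums.

(** * Behaviour of the metric under maps between direct sums *)

Section MonotoneMetric.
Context {R : realType}.
Variable K : forall n : nat, 'M[R[i]]_n -> 'M[R[i]]_n -> 'M[R[i]]_n -> R[i].
Hypothesis HK : cptni_monotone_metrics K.
Variable n : nat.
Hypothesis n_gt0 : (0 < n)%N.
Implicit Types (a b : 'M[R[i]]_n) (X Y : 'M[R[i]]_n).

Let nn_gt0 : (0 < n + n)%N. Proof. by rewrite addn_gt0 n_gt0. Qed.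

Lemma pos_substate_half_dsum a b : pos_substate a -> pos_substate b ->
  pos_substate (dsum (2^-1 *: a) (2^-1 *: b)).
Proof.
move=> [tr_a a_pos] [tr_b b_pos].
split; last by apply: posdefmx_dsum; exact: posdefmx_half.
rewrite mxtrace_block !mxtraceZ -mulrDr -ler_pdivlMl ?invr_gt0 ?ltr0n //.
by rewrite invrK mulr1 -[leRHS]/(1 + 1) lerD.
Qed.

Lemma pos_substate_half_mean a b : pos_substate a -> pos_substate b ->
  pos_substate (2^-1 *: (a + b)).
Proof.
move=> [tr_a a_pos] [tr_b b_pos]; split.
  rewrite mxtraceZ mxtraceD -ler_pdivlMl ?invr_gt0 ?ltr0n //.
  by rewrite invrK mulr1 -[leRHS]/(1 + 1) lerD.
apply: posdefmx_half => x x_neq0.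
by rewrite mulmxDr mulmxDl mxE addr_gt0 ?a_pos ?b_pos.
Qed.

(** Equations tie [rho'] and [X'] to [T], so that monotonicity applies directly to states and
    vectors in block form. *)
Lemma metric_contract {p q : nat} {T : 'M[R[i]]_p -> 'M[R[i]]_q}
    {rho X : 'M[R[i]]_p} {sigma rho' X' : 'M[R[i]]_q} :
  (0 < p)%N -> (0 < q)%N -> cptni T -> pos_substate rho -> substate sigma ->
  pos_substate rho' -> T rho + sigma = rho' -> T X = X' ->
  K q rho' X' X' <= K p rho X X.
Proof.
move=> p_gt0 q_gt0 T_cptni rho_pos sigma_sub + rho'E <-.
rewrite -rho'E => rho'_pos.
exact: (metric_monotone HK _ p_gt0 q_gt0 T_cptni rho_pos sigma_sub rho'_pos).
Qed.

(** Exchanging the summands is conjugation by a self-adjoint unitary. *)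
Lemma metric_swap a b X Y :
  pos_substate (dsum a b) -> pos_substate (dsum b a) ->
  K (n + n) (dsum b a) (dsum Y X) (dsum Y X) <=
  K (n + n) (dsum a b) (dsum X Y) (dsum X Y).
Proof.
move=> ab_pos ba_pos.
pose S : 'M[R[i]]_(n + n) := block_mx 0 1%:M 1%:M 0.
have SE : S ^t* = S.
  by rewrite /S tr_block_mx map_block_mx !trmx0 !map_mx0 !trmx1 !map_mx1.
have conjS c d : S *m dsum c d *m S ^t* = dsum d c.
  rewrite SE /S 2!mulmx_block.
  by rewrite !mulmx1 !mul1mx !mul0mx !mulmx0 !addr0 !add0r.
have S_cptni : cptni (fun Z => S *m Z *m S ^t*).
  apply: cptni1; rewrite SE /S mulmx_block !mulmx0 !mul0mx !mulmx1 !addr0 !add0r.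
  by rewrite -scalar_mx_block subrr; exact: psdmx0.
apply: (metric_contract nn_gt0 nn_gt0 S_cptni ab_pos (substate0 _) ba_pos _
          (conjS X Y)).
by rewrite conjS addr0.
Qed.

Let P : 'M[R[i]]_(n + n) := dsum 1%:M 0.

Let PE : P ^t* = P.
Proof. by rewrite /P tr_block_mx map_block_mx !trmx0 !map_mx0 trmx1 map_mx1. Qed.

Let conjP a b : P *m dsum a b *m P ^t* = dsum a 0.
Proof.
rewrite PE /P 2!mulmx_block.
by rewrite !mulmx1 !mul1mx !mul0mx !mulmx0 !addr0.
Qed.

(* The compression to the first summand kills [b]; adding [0 (+) c], as allowed
   by the trace non-increasing setting, replaces [b] by [c]. *)
Lemma metric_compress a b c X Y :
  pos_substate (dsum a b) -> pos_substate (dsum a c) ->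
  posdefmx a -> posdefmx c ->
  K (n + n) (dsum a c) (dsum X 0) (dsum X 0) <=
  K (n + n) (dsum a b) (dsum X Y) (dsum X Y).
Proof.
move=> ab_pos ac_pos a_pos c_pos.
have acE : dsum a c = P *m dsum a b *m P ^t* + dsum 0 c.
  by rewrite conjP add_block_mx !addr0 add0r.
have P_cptni : cptni (fun Z => P *m Z *m P ^t*).
  apply: cptni1; rewrite PE /P mulmx_block mulmx1 !mulmx0 !mul0mx !addr0.
  rewrite scalar_mx_block opp_block_mx add_block_mx !oppr0 !addr0 subrr.
  by apply: psdmx_dsum; [exact: psdmx0 | exact: psdmx1].
have c_sub : substate (dsum (0 : 'M_n) c).
  split; last by apply: psdmx_dsum; [exact: psdmx0 | exact: psd_posdefmx].
  (* Dropping [a] cannot raise the trace, since [\tr a] is nonnegative. *)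
  case: ac_pos => tr_ac _; apply: le_trans tr_ac.
  by rewrite !mxtrace_block mxtrace0 lerD2r posdefmx_trace_ge0.
exact: (metric_contract nn_gt0 nn_gt0 P_cptni ab_pos c_sub ac_pos (esym acE)
          (conjP X Y)).
Qed.

(** Compression with [c := b] keeps the state, so [dsum X 0] has the least norm among all
    [dsum X (t *: Y)]. It is therefore orthogonal to [dsum 0 Y]. *)
Lemma metric_dsum a b X Y :
  pos_substate (dsum a b) -> posdefmx a -> posdefmx b ->
  K (n + n) (dsum a b) (dsum X Y) (dsum X Y) =
  K (n + n) (dsum a b) (dsum X 0) (dsum X 0) +
  K (n + n) (dsum a b) (dsum 0 Y) (dsum 0 Y).
Proof.
move=> ab_pos a_pos b_pos.
have [g gE] := metric_inner_product HK nn_gt0 ab_pos.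
have -> : dsum X Y = dsum X 0 + dsum 0 Y by rewrite add_block_mx !addr0 !add0r.
rewrite !gE dnormD; suff -> : g (dsum X 0) (dsum 0 Y) = 0.
  by rewrite conjC0 !addr0.
apply: dot_orthogonal_of_minimal => t.
rewrite scale_block_mx !scaler0 add_block_mx !addr0 !add0r -!gE.
exact: metric_compress.
Qed.

(* The state is copied with weight 1/2 in each summand, and half of the
   resulting squared norm lies in each of them. *)
Lemma metric_half_dsum a b X :
  pos_substate a -> pos_substate b ->
  K (n + n) (dsum (2^-1 *: a) (2^-1 *: b))
    (dsum (2^-1 *: X) 0) (dsum (2^-1 *: X) 0) <= 2^-1 * K n a X X.
Proof.
move=> a_sub b_sub.
have a_pos : posdefmx (2^-1 *: a) by apply: posdefmx_half; case: a_sub.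
have b_pos : posdefmx (2^-1 *: b) by apply: posdefmx_half; case: b_sub.
have aa_sub := pos_substate_half_dsum _ _ a_sub a_sub.
have ab_sub := pos_substate_half_dsum _ _ a_sub b_sub.
(* The second summand of the state is replaced by another copy of [2^-1 *: a], which makes the state
   symmetric. *)
apply: le_trans (metric_compress _ _ _ (2^-1 *: X) 0 aa_sub ab_sub a_pos b_pos) _.
rewrite ler_pdivlMl ?ltr0n // mulr_natl mulr2n.
(* After doubling, one of the two equal terms moves to the other summand; additivity then merges
   both into the norm of the duplicated vector. *)
apply: le_trans (lerD (lexx _) (metric_swap _ _ 0 (2^-1 *: X) aa_sub aa_sub)) _.
rewrite -(metric_dsum _ _ _ _ aa_sub a_pos a_pos).
(* Each Kraus operator of the duplication carries the weight [c], so each copy has weight 1/2 and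
   the map preserves the trace. *)
pose c : R[i] := sqrtC 2^-1.
have c_conj : c^* = c by apply: geC0_conj; rewrite sqrtC_ge0 invr_ge0 ler0n.
have c2 : c * c = 2^-1 by rewrite -expr2 sqrtCK.
have half2 : 2^-1 + 2^-1 = 1 :> R[i] by rewrite [RHS]splitr mul1r.
pose A : 'M[R[i]]_(n + n, n) := col_mx c%:M 0.
pose B : 'M[R[i]]_(n + n, n) := col_mx 0 c%:M.
have AE : A ^t* = row_mx c%:M 0.
  by rewrite tr_col_mx map_row_mx trmx0 map_mx0 tr_scalar_mx map_scalar_mx /= c_conj.
have BE : B ^t* = row_mx 0 c%:M.
  by rewrite tr_col_mx map_row_mx trmx0 map_mx0 tr_scalar_mx map_scalar_mx /= c_conj.
have dup Z : A *m Z *m A ^t* + B *m Z *m B ^t* = dsum (2^-1 *: Z) (2^-1 *: Z).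
  rewrite AE BE !(mul_col_mx _ _ Z) !mul_col_row !mulmx0 !mul0mx add_block_mx !addr0 add0r.
  by rewrite mul_scalar_mx mul_mx_scalar scalerA c2.
have T_cptni : cptni (fun Z => A *m Z *m A ^t* + B *m Z *m B ^t*).
  apply: cptni2; rewrite AE BE !mul_row_col !mulmx0 addr0 add0r.
  rewrite -scalar_mxM c2 -raddfD /= half2 subrr.
  exact: psdmx0.
apply: (metric_contract n_gt0 nn_gt0 T_cptni a_sub (substate0 _) aa_sub _ (dup X)).
by rewrite dup addr0.
Qed.

(** The Kraus operators are the two block rows of the identity, so the map preserves the trace. *)
Lemma metric_partial_trace a b X Y :
  pos_substate (dsum a b) -> pos_substate (a + b) ->
  K n (a + b) (X + Y) (X + Y) <= K (n + n) (dsum a b) (dsum X Y) (dsum X Y).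
Proof.
move=> ab_pos sum_pos.
pose A : 'M[R[i]]_(n, n + n) := row_mx 1%:M 0.
pose B : 'M[R[i]]_(n, n + n) := row_mx 0 1%:M.
have AE : A ^t* = col_mx 1%:M 0.
  by rewrite tr_row_mx map_col_mx trmx0 map_mx0 trmx1 map_mx1.
have BE : B ^t* = col_mx 0 1%:M.
  by rewrite tr_row_mx map_col_mx trmx0 map_mx0 trmx1 map_mx1.
have ptr c d : A *m dsum c d *m A ^t* + B *m dsum c d *m B ^t* = c + d.
  rewrite AE BE !mul_row_block !mul_row_col.
  by rewrite !mulmx1 !mul1mx !mul0mx !mulmx0 !addr0 !add0r.
have T_cptni : cptni (fun Z => A *m Z *m A ^t* + B *m Z *m B ^t*).
  apply: cptni2; rewrite AE BE !mul_col_row !mulmx0 !mul0mx !mulmx1.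
  rewrite add_block_mx ?addr0 ?add0r -scalar_mx_block subrr.
  exact: psdmx0.
apply: (metric_contract nn_gt0 n_gt0 T_cptni ab_pos (substate0 _) sum_pos _ (ptr X Y)).
by rewrite ptr addr0.
Qed.

End MonotoneMetric.

Theorem corollary2p4 (R : realType)
    (K : forall n : nat, 'M[R[i]]_n -> 'M[R[i]]_n -> 'M[R[i]]_n -> R[i])
    (HK : cptni_monotone_metrics K)
    (n : nat) (n_gt0 : (0 < n)%N)
    (rho1 rho2 : 'M[R[i]]_n)
    (Hrho1 : pos_substate rho1) (Hrho2 : pos_substate rho2)
    (X1 X2 : 'M[R[i]]_n) :
  K n (2^-1 *: (rho1 + rho2)) (2^-1 *: (X1 + X2)) (2^-1 *: (X1 + X2))
    <= 2^-1 * (K n rho1 X1 X1 + K n rho2 X2 X2).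
Proof.
have rho12 := pos_substate_half_dsum _ _ _ Hrho1 Hrho2.
have rho21 := pos_substate_half_dsum _ _ _ Hrho2 Hrho1.
have mean := pos_substate_half_mean _ _ _ Hrho1 Hrho2.
(* The means become sums of halves, the form in which the partial trace produces them. *)
rewrite !scalerDr in mean *.
apply: le_trans (metric_partial_trace _ HK _ n_gt0 _ _ _ _ rho12 mean) _.
rewrite metric_dsum //; try by apply: posdefmx_half; case: Hrho1 Hrho2 => ? ? [].
rewrite mulrDr; apply: lerD; first exact: metric_half_dsum.
(* The vector in the second summand is swapped into the first, where the bound by half applies. *)
apply: le_trans (metric_swap _ HK _ n_gt0 _ _ _ _ rho21 rho12) _.
exact: metric_half_dsum.
Qed.
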